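(* Let $(a_j)_{j\ge 1}$ be real numbers with $A_0=\sum_j a_j^2<\infty$, and let $\mu$ be the invariant probability measure, concentrated on $H^2(\mathbb T^2)$, and $\rho_t$ the associated flow for the SQG equation $\theta_t+\mathbf u\cdot\nabla\theta=0$, both described in the context. For $\mu$-almost every $u_0\in H^2$ there is a sequence $(t_k)_k$ increasing to $\infty$ such that $$\lim_{k\to\infty}\|\rho_{t_k}u_0-u_0\|_{H^2}=0.$$
   Context: $\mathbb T^2$ is the flat two-dimensional torus; all functions on it are real-valued with zero mean. $(e_j)_{j\ge1}$ is an $L^2$-orthonormal basis of (zero-mean) eigenfunctions of $-\Delta$. $\|\cdot\|$ is the $L^2(\mathbb T^2)$ norm, $\|\theta\|_{H^s}=\|(-\Delta)^{s/2}\theta\|$, $\|\theta\|_{W^{1,4}}=\|\nabla\theta\|_{L^4}$. The velocity is $\mathbf u=(-\partial_y,\partial_x)(-\Delta)^{-1/2}\theta$. The stochastic SQG equation with parameter $\alpha\in(0,1)$ is $d\theta+\mathbf u\cdot\nabla\theta\,dt=-\alpha\Delta^2\theta\,dt+\alpha\nabla\cdot(|\nabla\theta|^2\nabla\theta)\,dt+\sqrt\alpha\,d\eta$, $\eta=\sum_ja_je_jW_j$ with $W_j$ independent standard Brownian motions. $\mu_\alpha$ is a stationary measure of it obtained as a weak limit along some $t_n\to\infty$ of the time averages $\frac1{t_n}\int_0^{t_n}\mathbb P(\theta(s)\in\cdot)\,ds$ for the solution with $\theta(0)=0$. The measure $\mu$ is an accumulation point of $(\mu_\alpha)$ as $\alpha\to0$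 (weak convergence of measures on $H^{2-\gamma}$, $\gamma>0$) such that: $\mu(H^2)=1$; for $\mu$-almost every $\theta_0$ there is a unique $\theta\in C(\mathbb R^+,H^1)\cap L^2_{loc}(\mathbb R^+,H^2)$ solving the SQG equation with $\theta(0)=\theta_0$, and one sets $\rho_t\theta_0=\theta(t)$; $\rho_t$ is continuous in the $H^1$ topology; and $\mu$ is invariant under $\rho_t$ for every $t\ge0$, i.e. $\mu\{\theta_0:\rho_t\theta_0\in A\}=\mu(A)$ for every Borel set $A\subset H^2$. *)

(* Defs.v *)
From HB Require Import structures.
From mathcomp Require Import all_boot all_order all_algebra.
From mathcomp Require Import all_classical all_reals all_analysis.
From mathcomp Require Import measurable_realfun.

Set Implicit Arguments.
Unset Strict Implicit.
Unset Printing Implicit Defensive.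
Import Order.TTheory GRing.Theory Num.Theory.
Import numFieldNormedType.Exports.

Local Open Scope classical_set_scope.
Local Open Scope ring_scope.

(** * The flat torus (R / 2 pi Z)^2, and real zero-mean functions on it *)

Notation plane R := (measurableTypeR R * measurableTypeR R)%type.

Section Torus.
Variable R : realType.

Definition torus_cell : set (plane R) := `[0, 2 * pi[ `*` `[0, 2 * pi[.

Lemma measurable_torus_cell : measurable torus_cell.
Proof. by apply: measurableX; exact: measurable_itv. Qed.

(** Lebesgue measure of the torus: functions on the torus are functions on the
    plane, whose values outside the cell are not seen by [torus_measure]. *)
Definition torus_measure : {measure set (plane R) -> \bar R} :=
  mrestr (@lebesgue_measure R \x @lebesgue_measure R)%E measurable_torus_cell.

(** Real zero-mean elements of L^2(T^2), modulo almost everywhere equality. *)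
Record L2zm := MkL2zm {
  L2zm_class :> LspaceType torus_measure (lee1n 2) ;
  L2zm_mean0 : \int[torus_measure]_x (L2zm_class x) = 0 }.
End Torus.

Section Zero.
Variable R : realType.
Local Notation mu := (torus_measure R).
Local Notation L2fun := {mfun_ mu, plane R >-> measurableTypeR R}.

Let zero_mfun : {mfun plane R >-> measurableTypeR R} := cst 0.
Definition L2_zero : L2fun := (\pi_L2fun zero_mfun)%qT.

Lemma L2_zeroE : \forall x \ae mu, L2_zero x = 0.
Proof.
have /eqmodP/asboolP : ((repr L2_zero)%qT = zero_mfun %[mod L2fun])%qT.
  by rewrite reprK.
by apply: filterS => x /(_ I).
Qed.

Lemma measurable_L2_zero : measurable_fun [set: plane R] L2_zero.
Proof. exact: (measurable_funP (repr L2_zero)). Qed.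

Lemma L2_zero_finite_norm : finite_norm mu 2%:E L2_zero.
Proof.
rewrite /finite_norm unlock; apply: poweR_lty.
rewrite (ae_eq_integral (cst 0%E)) ?integral0 //=.
- apply/measurable_EFinP.
  apply: (@measurableT_comp _ _ _ _ _ _ (fun x : R => `|x| `^ 2)%R).
    by apply: (@measurableT_comp _ _ _ _ _ _ (fun x : R => x `^ 2)%R).
  exact: measurable_L2_zero.
- apply: filterS L2_zeroE => x /= -> _.
  by rewrite normr0 powR0.
Qed.

HB.instance Definition _ :=
  isFinLebesgue.Build _ _ _ mu 2%:E (lee1n 2) L2_zero L2_zero_finite_norm.

Lemma L2_zero_mean0 : \int[mu]_x L2_zero x = 0.
Proof.
rewrite /Rintegral (ae_eq_integral (cst 0%E)) ?integral0 //=.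
- by apply/measurable_EFinP; exact: measurable_L2_zero.
- by apply: filterS L2_zeroE => x /= -> _.
Qed.

Definition L2zm_zero : L2zm R :=
  @MkL2zm R [the LspaceType mu (lee1n 2) of L2_zero] L2_zero_mean0.

HB.instance Definition _ := gen_eqMixin (L2zm R).
HB.instance Definition _ := gen_choiceMixin (L2zm R).
HB.instance Definition _ := isPointed.Build (L2zm R) L2zm_zero.
End Zero.

(** The Borel sigma-algebra of the L^2 norm is the measurable structure on the
    phase space of zero-mean functions. *)
Section Borel.
Variable R : realType.
Local Notation mu := (torus_measure R).

Definition L2norm (f : R * R -> R) : \bar R := 'N[mu]_2%:E[EFin \o f].

Definition L2open : set (set (L2zm R)) :=
  [set U | forall th : L2zm R, U th -> exists2 r : R, 0 < r &
     forall th' : L2zm R, (L2norm (fun x => th' x - th x)%R < r%:E)%E -> U th'].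

HB.instance Definition _ := @isMeasurable.Build (sigma_display L2open)
  (L2zm R) <<s L2open >> (@sigma_algebra0 _ setT L2open)
  (@sigma_algebraC _ L2open) (@sigma_algebra_bigcup _ setT L2open).
End Borel.

Section Calculus.
Variable R : realType.
Local Notation mu := (torus_measure R).
Implicit Types (f g phi : R * R -> R) (p : R * R).

Definition dx f : R * R -> R := fun p => derive1 (fun s => f (s, p.2)) p.1.
Definition dy f : R * R -> R := fun p => derive1 (fun s => f (p.1, s)) p.2.
Definition lap f : R * R -> R := fun p => dx (dx f) p + dy (dy f) p.

Fixpoint Cn (n : nat) f : Prop :=
  continuous f /\
  if n is m.+1 then
    [/\ forall p, derivable (fun s => f (s, p.2)) p.1 1,
        forall p, derivable (fun s => f (p.1, s)) p.2 1,
        Cn m (dx f) & Cn m (dy f)]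
  else True.

Definition smooth_torus f : Prop :=
  (forall n, Cn n f) /\
  (forall p, f (p.1 + 2 * pi, p.2) = f p /\ f (p.1, p.2 + 2 * pi) = f p).

Definition pair2 f g : R := \int[mu]_x (f x * g x).

(** Square integrable representatives of the weak partial derivatives; they are
    identically 0 when there is no square integrable weak derivative. *)
Definition weak_partial (d : (R * R -> R) -> R * R -> R) f : R * R -> R :=
  xget (cst 0) [set g | g \in Lfun mu 2%:E /\
    forall phi, smooth_torus phi -> pair2 g phi = - pair2 f (d phi)].
Definition wdx := weak_partial dx.
Definition wdy := weak_partial dy.

Definition grad_norm f : R * R -> R :=
  fun p => Num.sqrt (wdx f p ^+ 2 + wdy f p ^+ 2).

Definition W14norm f : \bar R := 'N[mu]_4%:E[EFin \o grad_norm f].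
End Calculus.

Section Spectral.
Variable R : realType.
Local Notation mu := (torus_measure R).

(** [e] is an L^2-orthonormal basis of the zero-mean functions made of
    eigenfunctions of -Delta, with eigenvalues [lam]; indices start at 0. *)
Record eigenbasis (e : nat -> R * R -> R) (lam : nat -> R) : Prop := {
  eigen_smooth : forall j, smooth_torus (e j) ;
  eigen_eq : forall j p, - lap (e j) p = lam j * e j p ;
  eigen_pos : forall j, 0 < lam j ;
  eigen_mean0 : forall j, \int[mu]_x e j x = 0 ;
  eigen_ortho : forall i j, pair2 (e i) (e j) = (i == j)%:R ;
  eigen_total : forall th : L2zm R,
    L2norm (fun x => th x - \sum_(j < n) pair2 th (e j) * e j x)
      @[n --> \oo] --> 0%E }.

Variables (e : nat -> R * R -> R) (lam : nat -> R).

(** The H^s norm ||(-Delta)^(s/2) f||, +oo if f is not in H^s: the coefficients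
    of (-Delta)^(s/2) f are the [lam j `^ (s / 2) * pair2 f (e j)]. *)
Definition Hnorm (s : R) (f : R * R -> R) : \bar R :=
  ((\sum_(0 <= j <oo) ((lam j `^ (s / 2) * pair2 f (e j)) ^+ 2)%:E) `^ 2^-1)%E.

Definition Hspace (s : R) : set (L2zm R) :=
  [set th | (Hnorm s th < +oo)%E].

Definition Hdist (s : R) (th th' : L2zm R) : \bar R :=
  Hnorm s (fun x => th x - th' x).

(** Continuity of a map, defined on the subset [D] of H^s, into H^s' *)
Definition Hcontinuous_on (s s' : R) (D : set (L2zm R)) (F : L2zm R -> L2zm R) :=
  forall th, D th -> forall eps : R, 0 < eps -> exists2 del : R, 0 < del &
    forall th', D th' -> (Hdist s th' th < del%:E)%E ->
      (Hdist s' (F th') (F th) < eps%:E)%E.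

Definition Hcvg_weak (s : R) (nu : nat -> probability (L2zm R) R)
    (nu0 : probability (L2zm R) R) : Prop :=
  [/\ forall n, nu n (Hspace s) = 1%E, nu0 (Hspace s) = 1%E &
    forall f : L2zm R -> R,
      (exists M : R, forall th, Hspace s th -> `|f th| <= M) ->
      (forall th, Hspace s th -> forall eps : R, 0 < eps ->
        exists2 del : R, 0 < del & forall th', Hspace s th' ->
          (Hdist s th' th < del%:E)%E -> `|f th' - f th| < eps) ->
      (\int[nu n]_(th in Hspace s) f th) @[n --> \oo] -->
        \int[nu0]_(th in Hspace s) f th].

(** psi = (-Delta)^(-1/2) theta *)
Definition stream (th : L2zm R) : L2zm R :=
  get [set psi : L2zm R | forall j,
    pair2 psi (e j) = lam j `^ (- 2^-1) * pair2 th (e j)].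

(** u . grad theta, where u = (- d_y psi, d_x psi) *)
Definition advection (th : L2zm R) : R * R -> R := fun p =>
  - wdy (stream th) p * wdx th p + wdx (stream th) p * wdy th p.

Definition path_C (s : R) (th : R -> L2zm R) : Prop :=
  (forall t, 0 <= t -> Hspace s (th t)) /\
  (forall t, 0 <= t -> forall eps : R, 0 < eps -> exists2 del : R, 0 < del &
    forall t', 0 <= t' -> `|t' - t| < del -> (Hdist s (th t') (th t) < eps%:E)%E).

(** L^p_loc in time of the (extended) norm [N] *)
Definition path_Lloc (p : nat) (N : (R * R -> R) -> \bar R) (th : R -> L2zm R) :=
  forall T : R, 0 < T ->
    measurable_fun `[0, T] (fun t => N (th t)) /\
    (\int[lebesgue_measure]_(t in `[0%R, T]) (N (th t) ^+ p) < +oo)%E.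

Definition time_integrable (t : R) (h : R -> R) : Prop :=
  lebesgue_measure.-integrable `[0, t] (EFin \o h).

(** Solutions in C(R^+, H^1) and L^2_loc(R^+, H^2), in the sense of
    distributions, of the SQG equation with initial datum [th0] *)
Definition sqg_solution (th0 : L2zm R) (th : R -> L2zm R) : Prop :=
  [/\ th 0 = th0, path_C 1 th, path_Lloc 2 (Hnorm 2) th &
    forall phi, smooth_torus phi -> forall t, 0 <= t ->
      time_integrable t (fun s => pair2 (advection (th s)) phi) /\
      pair2 (th t) phi = pair2 th0 phi
        - \int[lebesgue_measure]_(s in `[0, t]) pair2 (advection (th s)) phi].

Section SPDE.
Context (d : measure_display) (Omega : measurableType d).
Variables (P : probability Omega R) (F : R -> set (set Omega)).

Definition filtration : Prop :=
  (forall t, 0 <= t -> sigma_algebra setT (F t) /\ F t `<=` measurable) /\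
  (forall s t, 0 <= s -> s <= t -> F s `<=` F t).

(** A sequence of independent standard Brownian motions relative to [F]: given
    the past, the increments over ]s, t] are independent N(0, t - s). *)
Definition brownian_motions (W : nat -> R -> Omega -> R) : Prop :=
  [/\ forall j om, W j 0 om = 0,
      {ae P, forall om j, {within `[0, +oo[, continuous (fun t => W j t om)}},
      forall j t B, 0 <= t -> measurable B -> F t (W j t @^-1` B) &
      forall s t, 0 <= s -> s < t -> forall A, F s A ->
      forall (n : nat) (B : nat -> set R), (forall j, measurable (B j)) ->
        P (A `&` [set om | forall j, (j < n)%N -> B j (W j t om - W j s om)]) =
        (P A * \prod_(j < n) normal_prob 0 (Num.sqrt (t - s)) (B j))%E].

(** Drift of the equation tested against [phi]; the fourth order terms are
    integrated by parts. *)
Definition drift (alpha : R) (th : L2zm R) (phi : R * R -> R) : R :=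
  - pair2 (advection th) phi
  - alpha * pair2 th (lap (lap phi))
  - alpha * \int[mu]_x (grad_norm th x ^+ 2 *
                        (wdx th x * dx phi x + wdy th x * dy phi x)).

(** Solutions of the stochastic SQG equation with parameter [alpha] and noise
    sqrt alpha * sum_j a_j e_j W_j; since the noise is additive, the equation
    is an integral identity for almost every path. *)
Definition ssqg_solution (a : nat -> R) (W : nat -> R -> Omega -> R)
    (alpha : R) (th0 : L2zm R) (th : R -> Omega -> L2zm R) : Prop :=
  (forall t (A : set (L2zm R)), 0 <= t -> measurable A -> F t (th t @^-1` A)) /\
  {ae P, forall om,
    [/\ th 0 om = th0, path_C 0 (th^~ om), path_Lloc 2 (Hnorm 2) (th^~ om),
        path_Lloc 4 (@W14norm R) (th^~ om) &
      forall t j, 0 <= t ->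
        time_integrable t (fun s => drift alpha (th s om) (e j)) /\
        pair2 (th t om) (e j) = pair2 th0 (e j)
          + \int[lebesgue_measure]_(s in `[0, t]) drift alpha (th s om) (e j)
          + Num.sqrt alpha * a j * W j t om]}.

(** [Th t th0] is the solution at time t issued from [th0]. *)
Definition stationary (Th : R -> L2zm R -> Omega -> L2zm R)
    (nu : probability (L2zm R) R) : Prop :=
  forall t (A : set (L2zm R)), 0 <= t -> measurable A ->
    (\int[nu]_th0 P (Th t th0 @^-1` A) = nu A)%E.

(** [nu] is the weak limit of the time averages of the law of [th] along some
    times going to infinity. *)
Definition time_average_limit (th : R -> Omega -> L2zm R)
    (nu : probability (L2zm R) R) : Prop :=
  exists (t : nat -> R) (avg : nat -> probability (L2zm R) R),
    [/\ forall n, 0 < t n, t @ \oo --> +oo,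
        forall n (A : set (L2zm R)), measurable A ->
          (avg n A = (t n)^-1%:E *
            \int[lebesgue_measure]_(s in `[0%R, t n]) P (th s @^-1` A))%E &
        Hcvg_weak 0 avg nu].

End SPDE.
End Spectral.

(* Main.v *)
(** Poincare recurrence for the flow. Uniqueness of the solutions gives
    rho_(s + t) = rho_t rho_s wherever rho_s stays in the set D of good data.
    The points of a measurable set A in H^2 that never come back to A at the
    times m, 2m, 3m, ... therefore have disjoint preimages of equal measure, and
    are negligible. Since H^2 is separable, it is covered by countably many such
    sets A of arbitrarily small H^2 diameter.

    Measurability is read off the coefficients on the eigenbasis: by Bessel and
    Parseval they generate the Borel sets of L^2, and each coefficient of
    rho_t th0 is a continuous function of th0 for the H^1 norm, which is
    separable as well. Only lam j > 0 is used here, not a spectral gap. *)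
Require Import Defs.
From mathcomp Require Import all_boot all_order all_algebra.
From mathcomp Require Import all_classical all_reals all_analysis.
From mathcomp Require Import measurable_realfun ring lra.

Set Implicit Arguments.
Unset Strict Implicit.
Unset Printing Implicit Defensive.
Import Order.TTheory GRing.Theory Num.Theory.
Import numFieldNormedType.Exports.

Local Open Scope classical_set_scope.
Local Open Scope ring_scope.

Lemma countable_bigcup_measurable d (T : measurableType d) (I : countType)
    (P : set I) (F : I -> set T) :
  (forall i, P i -> measurable (F i)) -> measurable (\bigcup_(i in P) F i).
Proof.
move=> mF; rewrite bigcup_mkcond; apply: countable_bigcupT_measurable => // i.
by case: ifPn => // /[!inE] /mF.
Qed.

(** * Square integrable functions on the torus and their pairing *)

Section SquareIntegrable.
Variable R : realType.
Local Notation mu := (torus_measure R).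
Local Notation plane := (measurableTypeR R * measurableTypeR R)%type.
Local Notation L2 := (Lfun mu 2%:E).
Implicit Types f g h : plane -> R.

(** The plane carries the product sigma-algebra, so openness has to be turned into measurability:
    each superlevel set [f > a] is the union of the rational boxes it contains, and these are
    countably many. *)
Lemma continuous_measurable_plane (f : R * R -> R) :
  continuous f -> measurable_fun [set: plane] (f : plane -> R).
Proof.
move=> cf; apply: (measurability _ (RGenOInfty.measurableE R)) => //
  _ [_ [a ->] <-]; rewrite setTI.
pose box (q : rat * rat * rat) : set plane :=
  `]ratr q.1.1 - ratr q.2, ratr q.1.1 + ratr q.2[ `*`
  `]ratr q.1.2 - ratr q.2, ratr q.1.2 + ratr q.2[.
pose good q := box q `<=` f @^-1` `]a, +oo[.
have -> : f @^-1` `]a, +oo[ = \bigcup_(q in good) box q.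
  apply/seteqP; split=> [p fp|p [q gq /gq]] //.
  have : nbhs p (f @^-1` `]a, +oo[).
    by apply: cf; apply: open_nbhs_nbhs; split => //; exact: interval_open.
  move=> [[A B] /= [/nbhs_ballP[r1 r10 Ar] /nbhs_ballP[r2 r20 Br]] AB].
  (* The centre is within r/4 of [p] and the half-side [q] lies between r/4 and r/2: the box
     contains [p], and its points are within 3r/4 of [p] in each coordinate. *)
  pose r := Num.min r1 r2; have r0 : 0 < r by rewrite lt_min r10.
  have [q qr] : exists q : rat, ratr q \in `](r / 4), (r / 2)[.
    by apply: rat_in_itvoo; lra.
  have [u ur] : exists u : rat, ratr u \in `]p.1 - (r / 4), p.1 + (r / 4)[.
    by apply: rat_in_itvoo; lra.
  have [v vr] : exists v : rat, ratr v \in `]p.2 - (r / 4), p.2 + (r / 4)[.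
    by apply: rat_in_itvoo; lra.
  move: qr ur vr; rewrite !in_itv/= => /andP[? ?] /andP[? ?] /andP[? ?].
  exists ((u, v), q); last by split => /=; rewrite in_itv/=; lra.
  move=> [s t] [/=]; rewrite !in_itv/= => /andP[? ?] /andP[? ?].
  apply: (AB (s, t)); split => /=.
    apply: Ar; rewrite /ball/= ltr_norml.
    have : r <= r1 by rewrite ge_min lexx.
    lra.
  apply: Br; rewrite /ball/= ltr_norml.
  have : r <= r2 by rewrite ge_min lexx orbT.
  lra.
apply: countable_bigcup_measurable => q _.
by apply: measurableX; exact: measurable_itv.
Qed.

Lemma L2zm_Lfun (th : L2zm R) : (th : plane -> R) \in L2.
Proof.
rewrite inE; apply/andP; split; rewrite inE/=; last exact: Lebesgue_finite.
exact: (measurable_funP (repr (LebesgueSpace.sort (L2zm_class th)))).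
Qed.

Lemma pair2_integrable f g : f \in L2 -> g \in L2 ->
  mu.-integrable [set: plane] (EFin \o (fun x => f x * g x)).
Proof. by move=> f2 g2; apply/Lfun1_integrable; exact: Lfun2_mul_Lfun1. Qed.

Lemma pair2C f g : pair2 f g = pair2 g f.
Proof. by apply: eq_Rintegral => x _; rewrite mulrC. Qed.

Lemma pair2_ge0 f : 0 <= pair2 f f.
Proof. by apply: Rintegral_ge0 => x _; rewrite -expr2 sqr_ge0. Qed.

Lemma pair2Bl f g h : f \in L2 -> g \in L2 -> h \in L2 ->
  pair2 (fun x => f x - g x) h = pair2 f h - pair2 g h.
Proof.
move=> f2 g2 h2; rewrite /pair2 -RintegralB//; try exact: pair2_integrable.
by apply: eq_Rintegral => x _; rewrite mulrBl.
Qed.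

Lemma pair2Zl f h a : f \in L2 -> h \in L2 ->
  pair2 (fun x => a * f x) h = a * pair2 f h.
Proof.
move=> f2 h2; rewrite /pair2 -RintegralZl//; try exact: pair2_integrable.
by apply: eq_Rintegral => x _; rewrite mulrA.
Qed.

Lemma L2B f g : f \in L2 -> g \in L2 -> (fun x => f x - g x) \in L2.
Proof.
have p1 : (1 <= 2%:E :> \bar R)%E by rewrite lee_fin ler1n.
move=> f2 g2; have := (Lfun_submod_closed mu p1).2 (-1) g f g2 f2.
suff -> : -1 *: g + f = (fun x => f x - g x) by [].
by apply/funext => x; rewrite /= fctE scaleN1r addrC.
Qed.

Lemma L2Z f a : f \in L2 -> (fun x => a * f x) \in L2.
Proof.
move=> f2; have := @Lfun_scale _ _ _ mu f a 2 (ler1n _ 2) f2.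
suff -> : a \o* f = (fun x => a * f x) by [].
by apply/funext => x /=; rewrite mulrC.
Qed.

Lemma L2normE f : f \in L2 -> L2norm f = (Num.sqrt (pair2 f f))%:E.
Proof.
move=> f2; rewrite /L2norm unlock.
under eq_integral => x _ do rewrite /= powR_mulrn// real_normK ?num_real//.
have /integrable_fin_num : mu.-integrable setT (EFin \o (fun x => f x ^+ 2)).
  exact: Lfun2_integrable_sqr.
move=> /(_ measurableT) /fineK; rewrite /comp => <-.
rewrite poweR_EFin powR12_sqrt// -/(Rintegral _ _ _) Rintegral_ge0// => x _.
exact: sqr_ge0.
Qed.

Lemma L2norm_lt f (r : R) : f \in L2 -> 0 < r ->
  (L2norm f < r%:E)%E = (pair2 f f < r ^+ 2).
Proof.
move=> f2 r0; rewrite L2normE// lte_fin.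
by rewrite -(@ltr_pXn2r _ 2)// ?nnegrE ?sqrtr_ge0 1?ltW// sqr_sqrtr// pair2_ge0.
Qed.

(** The integrands of the two sides differ by the square of f + g. *)
Lemma pair2_sqrB_le f g : f \in L2 -> g \in L2 ->
  pair2 (fun x => f x - g x) (fun x => f x - g x) <=
  2 * pair2 f f + 2 * pair2 g g.
Proof.
move=> f2 g2.
have -> : 2 * pair2 f f + 2 * pair2 g g =
   \int[mu]_x (2 * (f x * f x) - -2 * (g x * g x)).
  rewrite RintegralB//=.
  - by rewrite !RintegralZl//; [rewrite mulNr opprK|exact: pair2_integrable..].
  - exact: (integrableZl measurableT 2 (pair2_integrable f2 f2)).
  - exact: (integrableZl measurableT (-2) (pair2_integrable g2 g2)).
apply: le_Rintegral => //.
- by apply: pair2_integrable; exact: L2B.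
- apply: (@integrableB _ _ _ mu setT measurableT
    (fun x => (2 * (f x * f x))%:E) (fun x => (-2 * (g x * g x))%:E)).
  + exact: (integrableZl measurableT 2 (pair2_integrable f2 f2)).
  + exact: (integrableZl measurableT (-2) (pair2_integrable g2 g2)).
- move=> x _; rewrite -subr_ge0.
  rewrite (_ : _ - _ = (f x + g x) ^+ 2) ?sqr_ge0//; ring.
Qed.
End SquareIntegrable.

(** * Bessel and Parseval inequalities for the eigenbasis *)

Section Bessel.
Variable R : realType.
Local Notation mu := (torus_measure R).
Local Notation plane := (measurableTypeR R * measurableTypeR R)%type.
Local Notation L2 := (Lfun mu 2%:E).
Implicit Types f g : plane -> R.

Lemma pair2B_diag f g : f \in L2 -> g \in L2 ->
  pair2 (fun x => f x - g x) (fun x => f x - g x) =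
  pair2 f f - 2 * pair2 f g + pair2 g g.
Proof.
move=> f2 g2; have fg2 := L2B f2 g2.
rewrite pair2Bl// (pair2C f) (pair2C g) !pair2Bl// (pair2C g f); ring.
Qed.

Variables (e : nat -> R * R -> R) (lam : nat -> R).
Hypothesis he : eigenbasis e lam.

Lemma eigen_L2 j : (e j : plane -> R) \in L2.
Proof.
have [+ _] := eigen_smooth he j => /(_ 0%N)[/continuous_measurable_plane me _].
rewrite inE; apply/andP; split; rewrite inE//=.
rewrite /finite_norm unlock; apply: poweR_lty.
under eq_integral => x _ do
  rewrite /= powR_mulrn// real_normK ?num_real// expr2.
(* [Rintegral] gives the value 0 to an infinite integral, so the normalisation to 1 forces the
   integral of the square to be finite. *)
have := eigen_ortho he j j; rewrite eqxx /pair2 /Rintegral.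
by case: integral => //= [*|/eqP]; rewrite ?ltry// eq_sym oner_eq0.
Qed.

(** For square integrable [f], the component of [f] orthogonal to the first [n] eigenfunctions. *)
Definition resid f n : plane -> R :=
  fun x => f x - \sum_(j < n) pair2 f (e j) * e j x.

Lemma resid0 f : resid f 0 = f.
Proof. by apply/funext => x; rewrite /resid big_ord0 subr0. Qed.

Lemma residS f n :
  resid f n.+1 = fun x => resid f n x - pair2 f (e n) * e n x.
Proof. by apply/funext => x; rewrite /resid big_ord_recr/= opprD addrA. Qed.

Lemma resid_L2 f n : f \in L2 -> resid f n \in L2.
Proof.
move=> f2; elim: n => [|n IHn]; first by rewrite resid0.
by rewrite residS; apply: L2B => //; apply: L2Z; exact: eigen_L2.
Qed.

Lemma residB f g n : f \in L2 -> g \in L2 ->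
  resid (fun x => f x - g x) n = fun x => resid f n x - resid g n x.
Proof.
move=> f2 g2; apply/funext => x; rewrite /resid.
under eq_bigr => j _ do rewrite pair2Bl ?eigen_L2// mulrBl.
by rewrite sumrB; ring.
Qed.

Lemma pair2_resid f n k : f \in L2 -> (n <= k)%N ->
  pair2 (resid f n) (e k) = pair2 f (e k).
Proof.
move=> f2; elim: n => [|n IHn] nk; first by rewrite resid0.
rewrite residS pair2Bl ?resid_L2 ?eigen_L2 ?L2Z ?eigen_L2//.
rewrite pair2Zl ?eigen_L2// IHn ?(ltnW nk)// (eigen_ortho he).
by rewrite (ltn_eqF nk) mulr0 subr0.
Qed.

(** Pythagoras, by induction: each step removes one eigenfunction, whose coefficient in the current
    residual is still that of [f]. *)
Lemma pair2_resid_diag f n : f \in L2 ->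
  pair2 (resid f n) (resid f n) =
  pair2 f f - \sum_(j < n) pair2 f (e j) ^+ 2.
Proof.
move=> f2; elim: n => [|n IHn]; first by rewrite resid0 big_ord0 subr0.
rewrite residS pair2B_diag ?resid_L2 ?L2Z ?eigen_L2// IHn big_ord_recr/=.
rewrite [pair2 (resid f n) _]pair2C !pair2Zl ?resid_L2 ?L2Z ?eigen_L2//.
rewrite [pair2 (e n) (resid f n)]pair2C pair2_resid//.
rewrite [pair2 (e n) _]pair2C pair2Zl ?eigen_L2// (eigen_ortho he) eqxx mulr1n.
ring.
Qed.

Lemma bessel f : f \in L2 ->
  (\sum_(0 <= j <oo) (pair2 f (e j) ^+ 2)%:E <= (pair2 f f)%:E)%E.
Proof.
move=> f2; apply: lime_le.
  by apply: is_cvg_nneseries => j _ _; rewrite lee_fin sqr_ge0.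
apply: nearW => n; rewrite big_mkord sumEFin lee_fin -subr_ge0.
by rewrite -pair2_resid_diag// pair2_ge0.
Qed.

Lemma pair2_sqr_le f j : f \in L2 -> pair2 f (e j) ^+ 2 <= pair2 f f.
Proof.
move=> f2; have : 0 <= pair2 (resid f j.+1) (resid f j.+1) by exact: pair2_ge0.
rewrite pair2_resid_diag// subr_ge0 big_ord_recr/=; apply: le_trans.
by rewrite lerDr sumr_ge0// => i _; exact: sqr_ge0.
Qed.

(* Two elements appear because [eigen_total] speaks of [L2zm] only, and the
   difference of two elements is only a function. *)
Lemma parseval_le (th th' : L2zm R) (f := fun x => th x - th' x) :
  ((pair2 f f)%:E <= \sum_(0 <= j <oo) (pair2 f (e j) ^+ 2)%:E)%E.
Proof.
have f2 : f \in L2 by apply: L2B; exact: L2zm_Lfun.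
have small (u : L2zm R) (eps : R) : 0 < eps ->
    \forall n \near \oo, pair2 (resid u n) (resid u n) < eps ^+ 2.
  move=> eps0; have eps0' : (0 < eps%:E)%E by rewrite lte_fin.
  have : \forall n \near \oo, (L2norm (resid u n) < eps%:E)%E.
    exact: (eigen_total he u (open_ereal_lt' eps0')).
  by apply: filterS => n; rewrite L2norm_lt ?resid_L2 ?L2zm_Lfun.
apply/lee_addgt0Pr => eps eps0.
have [r r0 r2] : exists2 r, 0 < r & 2 * r ^+ 2 + 2 * r ^+ 2 = eps.
  exists (Num.sqrt (eps / 4)); first by rewrite sqrtr_gt0 divr_gt0.
  by rewrite sqr_sqrtr ?divr_ge0 1?ltW//; field.
have [n [thn th'n]] := filter_ex (filterI (small th r r0) (small th' r r0)).
apply: (@le_trans _ _ ((\sum_(j < n) pair2 f (e j) ^+ 2 + eps)%:E)).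
  (* The mass missing from the partial sum is the squared norm of the residual of [f], a difference
     of two residuals of norm less than [r]. *)
  rewrite lee_fin -lerBlDl -pair2_resid_diag// residB ?L2zm_Lfun//.
  apply: (le_trans (pair2_sqrB_le (resid_L2 n (L2zm_Lfun th))
    (resid_L2 n (L2zm_Lfun th')))).
  rewrite -r2; apply: lerD.
    exact (ler_wpM2l (ler0n R 2) (ltW thn)).
  exact (ler_wpM2l (ler0n R 2) (ltW th'n)).
rewrite EFinD leeD2r// -sumEFin.
rewrite -(big_mkord xpredT (fun j => (pair2 f (e j) ^+ 2)%:E)).
by apply: nneseries_lim_ge => j _ _; rewrite lee_fin sqr_ge0.
Qed.
End Bessel.

(** * Weighted square sums and countably many balls with rational centres *)

Section WeightedSums.
Variable R : realType.
Implicit Types (w x y : nat -> R) (q : seq rat).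

Definition wsum w x : \bar R := (\sum_(0 <= j <oo) ((w j * x j) ^+ 2)%:E)%E.

(** The centre is a finite rational list continued by 0, so that centres form a countable type; [r]
    bounds the squared distance. *)
Definition wball w q (r : R) : set (nat -> R) :=
  [set x | (wsum w (fun j => (x j - ratr (nth 0 q j))%R) < r%:E)%E].

Lemma wsum_ge0 w x : (0 <= wsum w x)%E.
Proof. by apply: nneseries_ge0 => j _ _; rewrite lee_fin sqr_ge0. Qed.

Lemma wsum_sub_le w x y :
  (wsum w (fun j => (x j - y j)%R) <= 2%:E * wsum w x + 2%:E * wsum w y)%E.
Proof.
rewrite /wsum -!nneseriesZl; try by move=> j _; rewrite lee_fin sqr_ge0.
rewrite -nneseriesD; try by move=> j _ _; rewrite mule_ge0 ?lee_fin ?sqr_ge0.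
apply: lee_nneseries => j _; first by rewrite lee_fin sqr_ge0.
rewrite -!EFinM -EFinD lee_fin -subr_ge0.
rewrite (_ : _ - _ = (w j * x j + w j * y j) ^+ 2) ?sqr_ge0//; ring.
Qed.

(** Passing through the common centre costs a factor 2 for each of the two squared distances. *)
Lemma wball_sub w q r x y : wball w q r x -> wball w q r y ->
  (wsum w (fun j => (x j - y j)%R) < (4 * r)%:E)%E.
Proof.
rewrite /wball/= => xr yr.
have /le_lt_trans := wsum_sub_le w (fun j => x j - ratr (nth 0 q j))
  (fun j => y j - ratr (nth 0 q j)).
rewrite (_ : (fun j => _ - _ - _) = (fun j => x j - y j)); last first.
  by apply/funext => j; ring.
apply.
rewrite (_ : 4 * r = 2 * r + 2 * r); last by ring.
by rewrite [ltRHS]EFinD !(EFinM 2) lteD// lte_pmul2l.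
Qed.

Lemma wsum_coord_le w x j : (((w j * x j) ^+ 2)%:E <= wsum w x)%E.
Proof.
apply: (@le_trans _ _ (\sum_(0 <= k < j.+1) ((w k * x k) ^+ 2)%:E)%E);
  last first.
  by apply: nneseries_lim_ge => k _ _; rewrite lee_fin sqr_ge0.
rewrite big_nat_recr//= leeDr// sume_ge0// => i _.
by rewrite lee_fin sqr_ge0.
Qed.

(** Separability of the weighted space: cut the sequence where the tail falls below r/2, and
    approximate the remaining coordinates by rationals. *)
Lemma wball_dense w x (r : R) : (wsum w x < +oo)%E -> 0 < r ->
  exists q, wball w q r x.
Proof.
move=> xoo r0.
have [n tailn] : exists n,
    (\sum_(n <= j <oo) ((w j * x j) ^+ 2)%:E < (r / 2)%:E)%E.
  have r20 : (0 < (r / 2)%:E)%E by rewrite lte_fin divr_gt0.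
  have /(_ _ (open_ereal_lt' r20)) [n _ /(_ n (leqnn n))] :=
    nneseries_tail_cvg xoo (fun j _ => sqr_ge0 (w j * x j)).
  by exists n.
(* The first [n] terms, at most [d] each, add up to at most r/2; [n.+1] keeps the denominator
   positive. *)
pose d := r / (2 * n.+1%:R); have d0 : 0 < d by rewrite divr_gt0// mulr_gt0.
have approx j : exists u : rat, (w j * (x j - ratr u)) ^+ 2 <= d.
  (* Adding 1 covers a vanishing weight. *)
  pose s := Num.sqrt d / (`|w j| + 1).
  have wj : 0 < `|w j| + 1 by rewrite ltr_wpDl.
  have s0 : 0 < s by rewrite divr_gt0// sqrtr_gt0.
  have /rat_in_itvoo[u] : x j - s < x j + s by lra.
  rewrite in_itv/= => uxs; exists u.
  rewrite -[leRHS](sqr_sqrtr (ltW d0)) -ler_sqrt ?sqr_ge0// !sqrtr_sqr.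
  rewrite [leRHS]ger0_norm ?sqrtr_ge0// normrM.
  have -> : Num.sqrt d = (`|w j| + 1) * s by rewrite mulrC divfK// gt_eqF.
  apply: ler_pM => //; first by rewrite lerDl.
  by rewrite ler_norml; lra.
have [u hu] := choice approx.
exists (mkseq u n); rewrite /wball/= /wsum (nneseries_split 0 n) => [|j _].
  rewrite add0n (_ : r = r / 2 + r / 2); last by rewrite -splitr.
  rewrite EFinD lee_ltD//.
  - by rewrite sumEFin.
  - apply: (@le_trans _ _ (\sum_(0 <= j < n) d%:E)%E).
      rewrite big_nat [leRHS]big_nat; apply: lee_sum => j /andP[_ jn].
      by rewrite lee_fin nth_mkseq// hu.
    rewrite sumEFin lee_fin sumr_const_nat subn0 -[d *+ n]mulr_natr.
    rewrite mulrAC ler_pdivrMr ?mulr_gt0//.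
    have -> : r / 2 * (2 * n.+1%:R) = r * n.+1%:R by field.
    by rewrite ler_pM2l// ler_nat.
  (* Past the end of the list [nth] returns 0, so the terms are those of the tail of [x] itself. *)
  - apply: le_lt_trans tailn; rewrite eseries_cond [leRHS]eseries_cond.
    apply: lee_nneseries => [j _ _|j /andP[_ nj]].
      by rewrite lee_fin sqr_ge0.
    by rewrite nth_default ?size_mkseq// raddf0 subr0.
by rewrite lee_fin sqr_ge0.
Qed.

Lemma measurable_wsum d (T : measurableType d) (D : set T) w
    (c : T -> nat -> R) : measurable D ->
  (forall j, measurable_fun D (c ^~ j)) ->
  measurable_fun D (fun t => wsum w (c t)).
Proof.
move=> mD mc; apply: ge0_emeasurable_sum => [j t _ _|j _].
  by rewrite lee_fin sqr_ge0.
apply/measurable_EFinP; apply: measurable_funX; apply: measurable_funM => //.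
Qed.

Lemma measurable_wball d (T : measurableType d) (D : set T) w q r
    (c : T -> nat -> R) : measurable D ->
  (forall j, measurable_fun D (c ^~ j)) ->
  measurable (D `&` c @^-1` wball w q r).
Proof.
move=> mD mc.
have mW := @measurable_wsum _ _ D w (fun t j => c t j - ratr (nth 0 q j)) mD.
apply: (@emeasurable_fun_infty_o _ _ _ D _ mD (mW _)) => j.
exact: measurable_funB.
Qed.
End WeightedSums.

(** * Measurability in the phase space through the coefficients *)

Section PhaseSpace.
Variable R : realType.
Variables (e : nat -> R * R -> R) (lam : nat -> R).
Hypothesis he : eigenbasis e lam.
Implicit Types (s : R) (th : L2zm R).

Definition coef th j : R := pair2 th (e j).

Lemma coefB th th' j :
  pair2 (fun x => th x - th' x) (e j) = coef th j - coef th' j.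
Proof. by apply: pair2Bl; [exact: L2zm_Lfun..|exact: eigen_L2 he _]. Qed.

Local Notation hw s := (fun j => lam j `^ (s / 2)).

Lemma HspaceE s th : Hspace e lam s th <-> (wsum (hw s) (coef th) < +oo)%E.
Proof.
split; last exact: poweR_lty.
by apply: lty_poweRy; rewrite invr_neq0.
Qed.

Lemma Hdist_lt s th th' (r : R) : 0 < r ->
  (Hdist e lam s th th' < r%:E)%E =
  (wsum (hw s) (fun j => (coef th j - coef th' j)%R) < (r ^+ 2)%:E)%E.
Proof.
move=> r0; rewrite /Hdist /Hnorm.
under eq_eseriesr => j _ do rewrite coefB.
rewrite -/(wsum _ _); have := wsum_ge0 (hw s) (fun j => coef th j - coef th' j).
case: wsum => [x| |]//=; last first.
  by rewrite invr_eq0 pnatr_eq0/= !ltNge !leey.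
rewrite lee_fin !lte_fin => x0; rewrite powR12_sqrt//.
by rewrite -(@ltr_pXn2r _ 2)// ?nnegrE ?sqrtr_ge0 1?ltW// sqr_sqrtr.
Qed.

(** By Bessel a coefficient is 1-Lipschitz for the L^2 norm, so its superlevel sets are L^2-open:
    around [th] the radius [coef th j - a] is admissible. *)
Lemma measurable_coef j : measurable_fun [set: L2zm R] (coef ^~ j).
Proof.
apply: (measurability _ (RGenOInfty.measurableE R)) => //.
move=> _ [_ [a ->] <-]; rewrite setTI.
apply: sub_sigma_algebra => th /=; rewrite in_itv/= andbT => ath.
exists (coef th j - a); first by rewrite subr_gt0.
move=> th'; rewrite in_itv/= andbT.
have d2 : (fun x => th' x - th x : R) \in Lfun (torus_measure R) 2%:E.
  by apply: L2B; exact: L2zm_Lfun.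
rewrite L2norm_lt ?subr_gt0// => /(le_lt_trans (pair2_sqr_le he j d2)).
rewrite coefB => lt_sqr; rewrite ltNge; apply: contraTN lt_sqr => le_a.
have le_th := le_trans le_a (ltW ath).
rewrite -leNgt -[leRHS]sqrrN opprB ler_pXn2r ?nnegrE ?subr_ge0 ?(ltW ath)//.
by rewrite lerB.
Qed.

(** An L^2-open set is the union of the countably many unweighted balls it contains, and membership
    in such a ball is a measurable condition on the coefficients. *)
Lemma measurable_fun_coef d (X : measurableType d) (D : set X)
    (g : X -> L2zm R) :
  (forall j, measurable_fun D (fun x => coef (g x) j)) -> measurable_fun D g.
Proof.
move=> mg mD; apply: (measurability (L2open (R := R))) => //.
move=> _ [U oU <-].
pose B (i : seq rat * nat) : set (L2zm R) :=
  [set th | wball (cst 1) i.1 i.2.+1%:R^-1 (coef th)].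
have -> : U = \bigcup_(i in [set i | B i `<=` U]) B i.
  apply/seteqP; split => [th Uth|th [i iU /iU]]//.
  have [r r0 rU] := oU th Uth.
  (* Two points of a ball of squared radius 1/(n+1) are at squared distance below 4/(n+1), hence
     below [r ^+ 2]. *)
  have /ltr_add_invr[n] : 0 < (r ^+ 2) / 4 by rewrite divr_gt0// exprn_gt0.
  rewrite add0r => nr.
  have [q qth] : exists q, wball (cst 1) q n.+1%:R^-1 (coef th).
    apply: wball_dense; last by rewrite invr_gt0.
    rewrite /wsum; under eq_eseriesr => j _ do rewrite mul1r.
    exact: le_lt_trans (bessel he (L2zm_Lfun th)) (ltry _).
  exists (q, n) => //= th' /= qth'; apply: rU.
  have d2 : (fun x => th' x - th x : R) \in Lfun (torus_measure R) 2%:E.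
    by apply: L2B; exact: L2zm_Lfun.
  rewrite L2norm_lt// -lte_fin.
  apply: le_lt_trans (parseval_le he th' th) _.
  under eq_eseriesr => j _ do rewrite coefB -(mul1r (_ - _)).
  apply: lt_trans (wball_sub qth' qth) _.
  by rewrite lte_fin mulrC -ltr_pdivlMr.
rewrite preimage_bigcup setI_bigcupr.
by apply: countable_bigcup_measurable => i _; exact: measurable_wball.
Qed.

(** The same covering with H^s weights, relative to [D]: continuity for the H^s distance still gives
    sets measurable for the L^2 Borel structure. *)
Lemma measurable_Hcontinuous s (D : set (L2zm R)) (f : L2zm R -> R) :
  measurable D -> D `<=` Hspace e lam s ->
  (forall th, D th -> forall eps : R, 0 < eps -> exists2 del : R, 0 < del &
    forall th', D th' -> (Hdist e lam s th' th < del%:E)%E ->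
    `|f th' - f th| < eps) ->
  measurable_fun D f.
Proof.
move=> mD DH cf _; apply: (measurability _ (RGenOInfty.measurableE R)) => //.
move=> _ [_ [a ->] <-].
pose B (i : seq rat * nat) : set (L2zm R) :=
  D `&` [set th | wball (hw s) i.1 i.2.+1%:R^-1 (coef th)].
have -> : D `&` f @^-1` `]a, +oo[ =
    \bigcup_(i in [set i | B i `<=` f @^-1` `]a, +oo[]) B i.
  apply/seteqP; split => [th [Dth fth]|th [i iU Bth]]; last first.
    by split; [case: Bth|exact: iU].
  move: fth; rewrite /= in_itv/= andbT -subr_gt0 => fth.
  have [r r0 rU] := cf th Dth _ fth.
  have /ltr_add_invr[n] : 0 < (r ^+ 2) / 4 by rewrite divr_gt0// exprn_gt0.
  rewrite add0r => nr.
  have [q qth] : exists q, wball (hw s) q n.+1%:R^-1 (coef th).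
    by apply: wball_dense; [exact/HspaceE/DH|rewrite invr_gt0].
  exists (q, n) => //= th' [Dth' /= qth'].
  have : `|f th' - f th| < f th - a.
    apply: rU => //; rewrite Hdist_lt//.
    apply: lt_trans (wball_sub qth' qth) _.
    by rewrite lte_fin mulrC -ltr_pdivlMr.
  by rewrite in_itv/= andbT ltr_norml => /andP[+ _]; lra.
apply: countable_bigcup_measurable => i _.
apply: measurable_wball => // j.
exact: measurable_funS (measurable_coef j).
Qed.

Lemma measurable_Hflow s (D : set (L2zm R)) (g : L2zm R -> L2zm R) :
  measurable D -> D `<=` Hspace e lam s -> Hcontinuous_on e lam s s D g ->
  measurable_fun D g.
Proof.
move=> mD DH cg; apply: measurable_fun_coef => j.
apply: (measurable_Hcontinuous mD DH) => th Dth eps eps0.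
have hj : 0 < lam j `^ (s / 2) by rewrite powR_gt0// (eigen_pos he).
have epsj : 0 < lam j `^ (s / 2) * eps by rewrite mulr_gt0.
have [del del0 hdel] := cg th Dth _ epsj.
exists del => // th' Dth' /hdel - /(_ Dth'); rewrite Hdist_lt//.
move=> /(le_lt_trans (wsum_coord_le _ _ j)); rewrite lte_fin !exprMn.
rewrite ltr_pM2l ?exprn_gt0// => lt.
by rewrite -(@ltr_pXn2r _ 2)// ?nnegrE ?(ltW eps0)// real_normK ?num_real.
Qed.

Lemma measurable_Hspace s : measurable (Hspace e lam s).
Proof.
rewrite (_ : Hspace e lam s =
    setT `&` [set th | (wsum (hw s) (coef th) < +oo)%E]).
  apply: emeasurable_fun_infty_o => //.
  by apply: measurable_wsum => // j; exact: measurable_coef.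
by rewrite setTI; apply/seteqP; split=> th /HspaceE.
Qed.
End PhaseSpace.

(** * Translation invariance of Lebesgue integrals in time *)

Section Translation.
Variable R : realType.
Local Notation leb := (@lebesgue_measure R).
Implicit Types (D : set (measurableTypeR R)) (s t : R).

Let shift s : measurableTypeR R -> measurableTypeR R := fun x => s + x.

Lemma measurable_shift s : measurable_fun [set: measurableTypeR R] (shift s).
Proof. by apply: measurable_funD => //; exact: measurable_cst. Qed.

(** The translated measure gives half-open intervals their length, which characterises Lebesgue
    measure. *)
Lemma lebesgue_measureD s (A : set R) : measurable A ->
  pushforward leb (shift s) A = leb A.
Proof.
move=> mA; apply/esym.
apply: (lebesgue_measure_unique (mu := pushforward leb (shift s))) => //.
  exact: measurable_shift.
move=> ? _ [[a b]] _ <-; rewrite /pushforward.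
rewrite [X in _ = leb X](_ : _ = `]a - s, b - s]%classic); last first.
  by apply/seteqP; split=> x /=; rewrite !in_itv/= ltrBlDl lerBrDl.
rewrite !lebesgue_measure_itv/= !lte_fin ltrD2r -!EFinB.
by case: ifP => // _; congr EFin; ring.
Qed.

Lemma ge0_integral_shift s D (f : R -> \bar R) :
  measurable D -> measurable_fun D f -> (forall x, D x -> 0 <= f x)%E ->
  (\int[leb]_(x in shift s @^-1` D) f (s + x)%R = \int[leb]_(x in D) f x)%E.
Proof.
move=> mD mf f0.
rewrite -(ge0_integral_pushforward (measurable_shift s) leb mD mf).
  apply: eq_measure_integral => [|? A mA _]; first exact: measurable_shift.
  exact: lebesgue_measureD.
by move=> x /set_mem; exact: f0.
Qed.

Lemma integral_shift s D (f : R -> \bar R) :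
  measurable D -> measurable_fun D f ->
  (\int[leb]_(x in shift s @^-1` D) f (s + x)%R = \int[leb]_(x in D) f x)%E.
Proof.
move=> mD mf; rewrite [RHS]integralE [LHS]integralE.
rewrite -(@ge0_integral_shift s _ (f^\+)%E)//; last exact: measurable_funepos.
rewrite -(@ge0_integral_shift s _ (f^\-)%E)//; last exact: measurable_funeneg.
by congr (_ - _)%E; apply: eq_integral => x _; rewrite ?funeposE ?funenegE.
Qed.

Lemma preimage_shift_itv s t : shift s @^-1` `[s, s + t] = `[0, t]%classic.
Proof.
by apply/seteqP; split=> x /=; rewrite !in_itv/= lerDl lerD2l.
Qed.

Lemma measurable_fun_shift s t (f : R -> \bar R) :
  measurable_fun `[s, s + t] f ->
  measurable_fun `[0, t] (fun x => f (s + x)).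
Proof.
move=> mf; rewrite -(preimage_shift_itv s).
have : measurable_fun (shift s @^-1` `[s, s + t]) (f \o shift s); last by [].
apply: (measurable_comp _ _ mf) => //.
  by move=> _ [x xs <-].
exact: measurable_funS (measurable_shift s).
Qed.

Lemma itv_shift_sub s t : 0 <= s -> `[s, s + t] `<=` `[0, s + t].
Proof. by move=> s0 x; rewrite /= !in_itv/= => /andP[/(le_trans s0)-> ->]. Qed.

Lemma time_integrable_shift s t (h : R -> R) : 0 <= s ->
  time_integrable (s + t) h -> time_integrable t (fun x => h (s + x)).
Proof.
move=> s0 ih.
have {ih}/integrableP[mh ih] : leb.-integrable `[s, s + t] (EFin \o h).
  by apply: integrableS ih => //; exact: itv_shift_sub.
apply/integrableP; split; first exact: (measurable_fun_shift mh).
rewrite -(preimage_shift_itv s).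
rewrite (@ge0_integral_shift s _ (fun x => `|(h x)%:E|%E))//.
exact: measurableT_comp.
Qed.

Lemma Rintegral_shift s t (h : R -> R) : 0 <= s -> 0 <= t ->
  time_integrable (s + t) h ->
  \int[leb]_(x in `[0, s + t]) h x =
  \int[leb]_(x in `[0, s]) h x + \int[leb]_(x in `[0, t]) h (s + x).
Proof.
move=> s0 t0 ih.
have ih' : leb.-integrable `[s, s + t] (EFin \o h).
  by apply: integrableS ih => //; exact: itv_shift_sub.
have <- : \int[leb]_(x in `[s, s + t]) h x = \int[leb]_(x in `[0, t]) h (s + x).
  rewrite /Rintegral -(preimage_shift_itv s).
  rewrite -(@integral_shift s _ (EFin \o h))//.
  by case/integrableP : ih'.
(* The null point [s] is dropped, since the difference of the integrals up to [s + t] and up to [s]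
   is an integral over []s, s + t]]. *)
rewrite -Rintegral_itv_obnd_cbnd; last first.
  by apply: integrableS ih' => //; apply: subset_itvr; rewrite bnd_simp.
rewrite -(Rintegral_itvB ih) ?bnd_simp ?lerDl//.
by rewrite [RHS]addrC subrK.
Qed.
End Translation.

(** The equation is autonomous: the weak identity at time [s + t] minus the one at time [s] is the
    identity for the datum [th s]. With uniqueness this yields the composition law of the flow. *)
Lemma sqg_solution_shift (R : realType) (e : nat -> R * R -> R)
    (lam : nat -> R) (th0 : L2zm R) (th : R -> L2zm R) (s : R) : 0 <= s ->
  sqg_solution e lam th0 th ->
  sqg_solution e lam (th s) (fun t => th (s + t)).
Proof.
move=> s0 [_ [Hth cth] lth eqth]; split; first by rewrite addr0.
- split=> [t t0|t t0 eps eps0]; first by apply: Hth; exact: addr_ge0.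
  have [del del0 hdel] := cth (s + t) (addr_ge0 s0 t0) eps eps0.
  exists del => // t' t'0 tt'; apply: hdel; first exact: addr_ge0.
  by rewrite opprD addrACA subrr add0r.
- move=> T T0; have [mN iN] := lth (s + T) (ltr_wpDl s0 T0).
  split.
    apply: (@measurable_fun_shift _ s T (fun t => Hnorm e lam 2 (th t))).
    by apply: measurable_funS mN => //; exact: itv_shift_sub.
  pose N2 t := (Hnorm e lam 2 (th t) ^+ 2)%E.
  have mN2 : measurable_fun `[0, s + T] N2.
    exact: (emeasurable_funM mN mN).
  have N20 t : (0 <= N2 t)%E by rewrite expe_ge0// poweR_ge0.
  rewrite -(preimage_shift_itv s).
  rewrite (@ge0_integral_shift _ s _ N2)//; last first.
    by apply: measurable_funS mN2 => //; exact: itv_shift_sub.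
  apply: le_lt_trans iN.
  by apply: ge0_subset_integral => //; exact: itv_shift_sub.
- move=> phi sphi t t0.
  have [ih eqst] := eqth phi sphi (s + t) (addr_ge0 s0 t0).
  have [_ eqs] := eqth phi sphi s s0.
  split; first exact: time_integrable_shift s0 ih.
  rewrite eqst eqs (Rintegral_shift s0 t0 ih).
  rewrite opprD addrA; reflexivity.
Qed.

(** * Poincare recurrence for maps composing only on a set of good points *)

Section Recurrence.
Context d (T : measurableType d) (R : realType) (P : probability T R).
Variables (D A : set T) (g : nat -> T -> T).
Hypotheses (mD : measurable D) (mA : measurable A).
Hypothesis mg : forall k, measurable_fun D (g k).
Hypothesis gD : forall k l x, D x -> D (g k x) -> g (k + l)%N x = g l (g k x).
Hypothesis Pg : forall k B, measurable B -> B `<=` A ->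
  P (D `&` g k @^-1` B) = P B.

Lemma poincare_recurrence :
  P.-negligible [set x | [/\ D x, A x & forall n, ~ A (g n.+1 x)]].
Proof.
set B := [set x | _].
have mB : measurable B.
  have -> : B = (D `&` A) `\` \bigcup_n (D `&` g n.+1 @^-1` A).
    apply/seteqP; split=> [x [Dx Ax nA]|x [[Dx Ax] nA]].
      by split=> // -[n _ [_]]; exact: nA.
    by split=> // n An; apply: nA; exists n.
  apply: measurableD; first exact: measurableI.
  by apply: bigcupT_measurable => n; exact: mg.
exists B; split=> //.
pose C k := D `&` g k @^-1` B.
have mC k : measurable (C k) by exact: mg.
have PC k : P (C k) = P B by apply: Pg => // x [].
have tC : trivIset setT C.
  (* On [C i] the point [g i x] lies in [B], hence in [D], so [gD] reads [g j x] in [A] as a return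
     of [g i x] after [j - i] steps. Returns are numbered by [n.+1], whence the predecessor. *)
  have disj i j x : (i < j)%N -> C i x -> C j x -> False.
    move=> ij [Dx [Dix _ niA]] [_ [_ Aj _]]; apply: (niA (j - i).-1).
    by rewrite prednK ?subn_gt0// -gD// subnKC// ltnW.
  apply/trivIsetP => i j _ _ ij; apply/seteqP; split=> // x [Ci Cj].
  case: (ltngtP i j) ij => // [ij|ji] _.
    exact: (disj i j x).
  exact: (disj j i x).
have PBfin : P B \is a fin_num by exact: fin_num_measure.
pose b := fine (P B); have b0 : 0 <= b by rewrite fine_ge0.
have PB : P B = b%:E by rewrite fineK.
have bn n : b *+ n <= 1.
  rewrite -lee_fin; apply: (@le_trans _ _ (P (\bigcup_k C k))); last first.
    exact: probability_le1 (bigcupT_measurable _ mC).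
  rewrite measure_semi_bigcup//; last exact: bigcupT_measurable.
  apply: le_trans (nneseries_lim_ge n _) => //.
  rewrite (eq_bigr (fun=> b%:E)) => [|k _]; last by rewrite -PB; exact: PC.
  by rewrite sumEFin sumr_const_nat subn0.
rewrite PB; congr EFin; apply/eqP; rewrite eq_le b0 andbT leNgt.
apply/negP => b1.
(* More than 1/b disjoint sets of mass [b] exceed total mass 1. *)
have := bn (Num.bound b^-1); rewrite leNgt => /negP; apply.
rewrite -mulr_natr -ltr_pdivrMl// mulr1.
by apply: archi_boundP; rewrite invr_ge0.
Qed.
End Recurrence.

Lemma negligible_bigcup_countable d (T : measurableType d) (R : realType)
    (mu : {measure set T -> \bar R}) (I : countType) (F : I -> set T) :
  (forall i, mu.-negligible (F i)) -> mu.-negligible (\bigcup_i F i).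
Proof.
move=> nF.
pose G k := if unpickle k is Some i then F i else set0.
apply: (@negligibleS _ _ _ mu (\bigcup_k G k)).
  by move=> x [i _ Fx]; exists (pickle i) => //; rewrite /G pickleK.
apply: negligible_bigcup => k; rewrite /G.
by case: unpickle => [i|]; [exact: nF|exact: negligible_set0].
Qed.

(** * Recurrence of the SQG flow in H^2 *)

Theorem corollary1p4 (R : realType)
  (* eigenbasis of -Delta and coefficients of the noise *)
  (e : nat -> R * R -> R) (lam : nat -> R) (he : eigenbasis e lam)
  (a : nat -> R) (hA0 : (\sum_(0 <= j <oo) (a j ^+ 2)%:E < +oo)%E)
  (* stochastic basis and driving Brownian motions *)
  (d : measure_display) (Omega : measurableType d) (P : probability Omega R)
  (F : R -> set (set Omega)) (hF : filtration F)
  (W : nat -> R -> Omega -> R) (hW : brownian_motions P F W)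
  (* Theta alpha t theta0 : solution at time t of the stochastic equation *)
  (Theta : R -> R -> L2zm R -> Omega -> L2zm R)
  (hTheta : forall alpha th0, 0 < alpha < 1 ->
     ssqg_solution e lam P F a W alpha th0 (fun t => Theta alpha t th0))
  (mu_ : R -> probability (L2zm R) R)
  (hmu_stat : forall alpha, 0 < alpha < 1 ->
     stationary P (Theta alpha) (mu_ alpha))
  (hmu_lim : forall alpha, 0 < alpha < 1 ->
     time_average_limit e lam P (fun t => Theta alpha t (L2zm_zero R))
       (mu_ alpha))
  (* mu is an accumulation point of mu_ alpha as alpha tends to 0 *)
  (mu : probability (L2zm R) R)
  (hmu_acc : exists alpha : nat -> R,
     [/\ forall n, 0 < alpha n < 1, alpha @ \oo --> 0 &
       forall gamma, 0 < gamma <= 2 ->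
         Hcvg_weak e lam (2 - gamma) (fun n => mu_ (alpha n)) mu])
  (hmuH2 : mu (Hspace e lam 2) = 1%E)
  (* the SQG flow, on a set D of full measure *)
  (rho : R -> L2zm R -> L2zm R)
  (D : set (L2zm R)) (hD : measurable D) (hmuD : mu D = 1%E)
  (hrho_sol : forall th0, D th0 ->
     sqg_solution e lam th0 (fun t => rho t th0) /\
     forall th, sqg_solution e lam th0 th ->
       forall t, 0 <= t -> th t = rho t th0)
  (hrho_cont : forall t, 0 <= t -> Hcontinuous_on e lam 1 1 D (rho t))
  (hrho_inv : forall t (A : set (L2zm R)), 0 <= t ->
     measurable A -> A `<=` Hspace e lam 2 ->
     mu (D `&` rho t @^-1` A) = mu A) :
  {ae mu, forall u0 : L2zm R, Hspace e lam 2 u0 ->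
    exists t : nat -> R,
      [/\ forall k, 0 <= t k,
          forall k, t k < t k.+1,
          t @ \oo --> +oo,
          forall k, Hspace e lam 2 (rho (t k) u0) &
          Hdist e lam 2 (rho (t k) u0) u0 @[k --> \oo] --> 0%E]}.
Proof.
have D_H1 : D `<=` Hspace e lam 1.
  move=> th0 Dth0; have [[rho0 [H1 _] _ _] _] := hrho_sol _ Dth0.
  by rewrite -rho0; exact: H1.
have rho_meas t : 0 <= t -> measurable_fun D (rho t).
  by move=> t0; exact: (measurable_Hflow he hD D_H1 (hrho_cont _ t0)).
have rho_add s t th0 : 0 <= s -> 0 <= t -> D th0 -> D (rho s th0) ->
    rho (s + t) th0 = rho t (rho s th0).
  move=> s0 t0 Dth0 Drho.
  have [sol _] := hrho_sol _ Dth0.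
  have [_ uniq] := hrho_sol _ Drho.
  exact: (uniq _ (sqg_solution_shift s0 sol) t t0).
(* Countably many H^2 balls of arbitrarily small radius; intersecting with H^2 puts their subsets
   within reach of [hrho_inv]. *)
pose A (i : seq rat * nat) : set (L2zm R) := Hspace e lam 2 `&`
  [set th | wball (fun j => lam j `^ (2 / 2)) i.1 i.2.+1%:R^-1 (coef e th)].
have mA i : measurable (A i).
  apply: measurable_wball; first exact: measurable_Hspace.
  by move=> j; exact: measurable_funS (measurable_coef he j).
(* The time step [i.2.+1] is part of the index: returns along multiples of every step provide return
   times beyond any bound. *)
pose bad (i : (seq rat * nat) * nat) : set (L2zm R) :=
  [set th | [/\ D th, A i.1 th &
     forall n, ~ A i.1 (rho (n.+1 * i.2.+1)%:R th)]].
have nbad i : mu.-negligible (bad i).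
  apply: (poincare_recurrence (g := fun k => rho (k * i.2.+1)%:R)) => //.
  - by move=> k; exact: rho_meas.
  - by move=> k l th Dth Dk; rewrite mulnDl natrD; exact: rho_add.
  - by move=> k B mB BA; apply: hrho_inv => // th /BA[].
have nN : mu.-negligible (~` D `|` \bigcup_i bad i).
  apply: negligibleU; last exact: negligible_bigcup_countable.
  apply/negligibleP; first exact: measurableC.
  by have := probability_setC mu hD; rewrite hmuD subee.
apply: negligibleS nN => u0 /=; apply: contra_notP.
move=> /not_orP[/contrapT Du0 good] Hu0.
have next (kN : nat * nat) : exists N : nat,
    [/\ (kN.2 < N)%N, Hspace e lam 2 (rho N%:R u0) &
     (Hdist e lam 2 (rho N%:R u0) u0 < (kN.1.+1%:R^-1)%:E)%E].
  case: kN => k N /=.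
  have k0 : 0 < k.+1%:R^-1 :> R by rewrite invr_gt0.
  have /ltr_add_invr[n] : 0 < (k.+1%:R^-1 ^+ 2) / 4 :> R.
    by rewrite divr_gt0// exprn_gt0.
  rewrite add0r => nk.
  have [q qu0] : exists q,
      wball (fun j => lam j `^ (2 / 2)) q n.+1%:R^-1 (coef e u0).
    by apply: wball_dense; [exact/HspaceE|rewrite invr_gt0].
  (* With step [N.+1], every return time exceeds [N]; a point with no return would lie in
     [bad ((q, n), N)]. *)
  have [l [Hl ql]] : exists l, A (q, n) (rho (l.+1 * N.+1)%:R u0).
    apply: contrapT => /forallNP nl; apply: good.
    by exists ((q, n), N).
  exists (l.+1 * N.+1)%N; split => //.
    by rewrite mulSn addSn ltnS leq_addr.
  rewrite Hdist_lt//; apply: lt_trans (wball_sub ql qu0) _.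
  by rewrite lte_fin mulrC -ltr_pdivlMr.
have [f hf] := choice next.
(* Each time is chosen after the previous one, with precision 1/(k+1). *)
pose tau := fix tau k : nat := if k is k'.+1 then f (k, tau k') else f (0, 0)%N.
have tau_prev k : exists N, tau k = f (k, N) by case: k => [|k]; eexists.
have lt_tau k : (tau k < tau k.+1)%N by have [] := hf (k.+1, tau k).
have le_tau k : (k <= tau k)%N.
  by elim: k => // k IHk; exact: leq_ltn_trans (lt_tau k).
exists (fun k => (tau k)%:R); split => //.
- by move=> k; rewrite ltr_nat.
- apply: (@ger_cvgy _ _ _ _ (fun k => k%:R)); last exact: cvgr_idn.
  by apply: nearW => k; rewrite ler_nat.
- by move=> k; have [N ->] := tau_prev k; have [] := hf (k, N).
- apply: (@squeeze_cvge _ _ _ _ (cst 0%E) _ (fun k => (k.+1%:R^-1)%:E)).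
  + apply: nearW => k; rewrite poweR_ge0/=.
    by have [N ->] := tau_prev k; have [_ _ /ltW] := hf (k, N).
  + exact: cvg_cst.
  + by apply: cvg_EFin; [exact: nearW|exact: cvg_harmonic].
Qed.
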